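(* Let $A$ be a finite abelian group and let $G=A\rtimes C_2$ be the generalized dihedral group in which $C_2$ acts on $A$ by inversion. Then $G$ is power-chordal if and only if $A$ is power-chordal.
   Context: The power graph of a group $G$ is the simple graph with vertex set $G$ in which two distinct elements $x,y$ are joined by an edge if and only if $x^m=y$ or $y^m=x$ for some $m\in\mathbb{N}$. A graph is chordal if it has no induced cycle on at least four vertices. A group is power-chordal if its power graph is chordal. *)

(* Defs.v *)
From mathcomp Require Import all_boot all_fingroup.

Set Implicit Arguments.
Unset Strict Implicit.
Unset Printing Implicit Defensive.

Local Open Scope group_scope.

(* A simple graph is given by a vertex set V in an ambient finite type T and a
   symmetric irreflexive adjacency relation e on T, restricted to V. *)

(* c lists, in cyclic order, the vertices of an induced cycle of length n of
   (V, e), for n >= 3; ordS is the successor modulo n on 'I_n. *)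
Definition induced_cycle (T : finType) (V : {set T}) (e : T -> T -> Prop)
    (n : nat) (c : 'I_n -> T) : Prop :=
  [/\ forall i, c i \in V,
      injective c
    & forall i j, e (c i) (c j) <-> (j = ordS i \/ i = ordS j)].

Definition chordal (T : finType) (V : {set T}) (e : T -> T -> Prop) : Prop :=
  forall (n : nat) (c : 'I_n -> T), 4 <= n -> ~ induced_cycle V e c.

(* The exponent m = 0 is allowed; in a finite group this gives the same graph
   as m >= 1, since x ^+ 0 = x ^+ #[x]. *)
Definition power_adj (gT : finGroupType) (x y : gT) : Prop :=
  x <> y /\ exists m : nat, x ^+ m = y \/ y ^+ m = x.

Definition power_chordal (gT : finGroupType) (G : {group gT}) : Prop :=
  chordal G (@power_adj gT).

(* G is the (internal) semidirect product of A by a group C of order 2 whose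
   generator inverts A; the action is conjugation, a ^ t = t^-1 * a * t. *)
Definition generalized_dihedral (gT : finGroupType) (A C G : {group gT}) :
    Prop :=
  [/\ A ><| C = G, #|C| = 2 & {in A & C^#, forall a t, a ^ t = a^-1}].

(* Main.v *)
Require Import Defs.
From mathcomp Require Import all_boot all_fingroup.
From mathcomp Require Import cyclic.

(** Every element of [G] outside [A] is a reflection [a * t], hence an
    involution.  The only proper power of an involution is [1], and an
    reflection is neither a power of an element of [A] nor of
    another reflection; so in the power graph its only neighbour is [1].  A
    vertex of an induced cycle has two distinct neighbours on the cycle
    ([induced_cycle_two_neighbours]), so induced cycles of [G] live inside [A]
    ([reflection_neighbour]).  Conversely the power graph of [A] is the
    subgraph of that of [G] induced on [A], and chordality is inherited by
    induced subgraphs ([chordal_sub]). *)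

Local Open Scope group_scope.

Lemma chordal_sub (T : finType) (U V : {set T}) (e : T -> T -> Prop) :
  U \subset V -> chordal V e -> chordal U e.
Proof.
move=> /subsetP sUV chV n c n4 [cU cI ce].
by apply: (chV n c n4); split=> // i; apply: sUV.
Qed.

Lemma ordS_neq_ord_pred {n : nat} (i : 'I_n) : 2 < n -> ordS i != ord_pred i.
Proof.
move=> n3; apply/eqP=> eq_i.
have: ordS (ordS i) = i by rewrite eq_i ord_predK.
move/(congr1 val)=> /= /eqP.
rewrite -addn1 modnDml addn1 -addn2 -[X in _ == X](modn_small (ltn_ord i)).
by rewrite -[X in _ == X %% _]addn0 eqn_modDl mod0n modn_small.
Qed.

Lemma induced_cycle_two_neighbours {T : finType} {V : {set T}}
    {e : T -> T -> Prop} {n : nat} {c : 'I_n -> T} (i : 'I_n) :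
  2 < n -> induced_cycle V e c ->
  exists y z, [/\ y \in V, z \in V, y <> z, e (c i) y & e (c i) z].
Proof.
move=> n3 [cV cI ce]; exists (c (ordS i)), (c (ord_pred i)).
split=> //.
- by move/cI/eqP; apply/negP/ordS_neq_ord_pred.
- by apply/ce; left.
- by apply/ce; right; rewrite ord_predK.
Qed.

Lemma expg_involution {gT : finGroupType} (x : gT) (m : nat) :
  x ^+ 2 = 1 -> x ^+ m = 1 \/ x ^+ m = x.
Proof.
move=> x2; rewrite -(expg_mod m x2) modn2.
by case: (odd m); [right; rewrite expg1 | left].
Qed.

Lemma reflection_sqr (gT : finGroupType) (A C G : {group gT}) (x : gT) :
  generalized_dihedral A C G -> x \in G -> x \notin A -> x ^+ 2 = 1.
Proof.
case=> defG oC inv Gx; move: Gx; rewrite -(sdprodW defG).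
case/mulsgP=> a t Aa Ct -> {x}; rewrite groupMl // => Ant.
have t1 : t != 1 by apply: contraNneq Ant => ->; apply: group1.
have t2 : t * t = 1 by have := expg_cardG Ct; rewrite oC expgS expg1.
have := inv a t Aa; rewrite !inE t1 Ct => /(_ isT).
(* As [t] is an involution, [t * a * t] is the conjugate [a ^ t = a^-1]. *)
have tV : t^-1 = t by rewrite -[LHS]mulg1 -t2 mulKg.
rewrite conjgE tV => tat.
by rewrite expgS expg1 -mulgA tat mulgV.
Qed.

(** A path leaving a reflection in the power graph must go through [1]; this is
    what keeps induced cycles away from the reflections. *)
Lemma reflection_neighbour (gT : finGroupType) (A C G : {group gT})
    (x y : gT) :
  generalized_dihedral A C G -> x \in G -> x \notin A -> y \in G ->
  power_adj x y -> y = 1.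
Proof.
move=> dihG Gx Anx Gy [xy [m [xm | ym]]].
  have [] := expg_involution x m (reflection_sqr _ _ _ _ _ dihG Gx Anx);
    by rewrite xm => // /esym.
have Any : y \notin A by apply: contra Anx => Ay; rewrite -ym groupX.
have [] := expg_involution y m (reflection_sqr _ _ _ _ _ dihG Gy Any).
  by rewrite ym => x1; rewrite x1 group1 in Anx.
by rewrite ym.
Qed.

Theorem lemma3p15 (gT : finGroupType) (A C G : {group gT})
    (abA : abelian A) (dihG : generalized_dihedral A C G) :
  power_chordal G <-> power_chordal A.
Proof.
split.
  apply: chordal_sub; case: dihG => defG _ _.
  by have [/andP[]] := sdprod_context defG.
move=> chA n c n4 cyc; have [cG cI ce] := cyc.
apply: (chA n c n4); split=> // i; apply/negPn/negP=> Anc.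
have [y [z [Gy Gz yz xy xz]]] := induced_cycle_two_neighbours i (ltnW n4) cyc.
apply: yz; rewrite (reflection_neighbour _ _ _ _ _ _ dihG _ Anc Gy xy) //.
by rewrite (reflection_neighbour _ _ _ _ _ _ dihG _ Anc Gz xz).
Qed.
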